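(* Let $k$ and $n$ be positive integers, let $m=4k+1$, and let $G=P_m\mathbin{\square} P_n$. Then $\mathrm{a}_2'(G)\ge 3$.
   Context: $P_n$ denotes the path on $n$ vertices. The Cartesian product $G\mathbin{\square} F$ has vertex set $V(G)\times V(F)$, with $(x,y)$ and $(x',y')$ adjacent iff either $x=x'$ and $yy'\in E(F)$, or $y=y'$ and $xx'\in E(G)$. For positive integers $a,b$, the $(a,b)$-biased Maker-Breaker domination game on a graph $G$ is played by Dominator and Staller, who move alternately; on each move Dominator selects $a$ unplayed vertices and Staller selects $b$ unplayed vertices (if fewer unplayed vertices remain than the player's bias, the player selects all remaining ones). Dominator wins if the vertices he selected during the game form a dominating set of $G$; otherwise Staller wins, equivalently, Staller wins iff she claims all vertices of the closed neighborhood of some vertex. In the S-game Staller moves first, and $\mathrm{a}'_\ell(G)$ is the minimum positive integer $a$ such that Dominator wins the $(a,\ell)$-biased S-game on $G$ under optimal play ($\infty$ if no such $a$ exists). *)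

(* Defs.v *)
(* Mathematical Components; boolp is used only to turn propositions into
   booleans, and constructive_ereal only for the order on \bar int. *)
From mathcomp Require Import all_boot all_order all_algebra.
From mathcomp Require Import boolp constructive_ereal.

Set Implicit Arguments.
Unset Strict Implicit.
Unset Printing Implicit Defensive.

Local Open Scope nat_scope.

Record sgraph := SGraph {
  vertex :> finType;
  adj : rel vertex;
  adj_sym : symmetric adj;
  adj_irrefl : irreflexive adj
}.

Section Path.
Variable n : nat.

Definition path_adj : rel 'I_n := fun i j => (i.+1 == j) || (j.+1 == i).

Lemma path_adj_sym : symmetric path_adj.
Proof. by move=> i j; rewrite /path_adj orbC. Qed.

Lemma path_adj_irrefl : irreflexive path_adj.
Proof. by move=> i; rewrite /path_adj orbb gtn_eqF. Qed.

Definition path_graph : sgraph := SGraph path_adj_sym path_adj_irrefl.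

End Path.

Section CartesianProduct.
Variables G F : sgraph.

Definition cart_adj : rel (G * F) := fun u v =>
  ((u.1 == v.1) && adj u.2 v.2) || ((u.2 == v.2) && adj u.1 v.1).

Lemma cart_adj_sym : symmetric cart_adj.
Proof.
move=> u v.
by rewrite /cart_adj (eq_sym u.1) (eq_sym u.2) (adj_sym u.1) (adj_sym u.2).
Qed.

Lemma cart_adj_irrefl : irreflexive cart_adj.
Proof. by move=> u; rewrite /cart_adj !adj_irrefl !andbF. Qed.

Definition cart_prod : sgraph := SGraph cart_adj_sym cart_adj_irrefl.

End CartesianProduct.

Section Game.
Variable G : sgraph.

Definition dominating (D : {set G}) : bool :=
  [forall v, (v \in D) || [exists u in D, adj u v]].

Inductive player := Dominator | Staller.

(* In all that follows D and S are the sets of vertices selected so far by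
   Dominator and by Staller. *)
Definition unplayed (D S : {set G}) : {set G} := ~: (D :|: S).

Definition legal_move (bias : nat) (D S M : {set G}) : bool :=
  (M \subset unplayed D S) && (#|M| == minn bias #|unplayed D S|).

(* [dominator_wins a b p D S]: under optimal play from position (D, S) with
   player p to move, Dominator wins the (a,b)-biased game.  For positive biases
   each move decreases the number of unplayed vertices, so that every play is
   finite and this inductive definition is backward induction. *)
Inductive dominator_wins (a b : nat) :
    player -> {set G} -> {set G} -> Prop :=
| Wins_end p D S :
    unplayed D S = set0 -> dominating D -> dominator_wins a b p D S
| Wins_Dominator_move D S M :
    unplayed D S != set0 -> legal_move a D S M ->
    dominator_wins a b Staller (D :|: M) S ->
    dominator_wins a b Dominator D S
| Wins_Staller_move D S :
    unplayed D S != set0 ->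
    (forall M, legal_move b D S M ->
       dominator_wins a b Dominator D (S :|: M)) ->
    dominator_wins a b Staller D S.

Definition dominator_wins_Sgame (a b : nat) : Prop :=
  dominator_wins a b Staller set0 set0.

Definition Sgame_winning_bias (l : nat) : pred nat :=
  fun a => (0 < a) && `[< dominator_wins_Sgame a l >].

(* The threshold a'_l(G); +oo when no bias lets Dominator win. *)
Definition Sgame_threshold (l : nat) : \bar int :=
  if pselect (exists a, Sgame_winning_bias l a) is left ex
  then (ex_minn ex)%:Z%:E else +oo%E.

End Game.

(* Main.v *)
(** Write [v_0, ..., v_4k] for a side of the grid of length [4k+1] and [w_i] for
the neighbour of [v_i] on the next line.  Staller takes the odd vertices
[v_1, v_3, ...] in order, two at a time.  Once the odd neighbours of [v_2c] are
hers, Dominator must own a vertex of the pair [{v_2c, w_2c}], or she completes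
the closed neighbourhood of [v_2c].  These pairs are disjoint, and each of the
first [k-1] moves creates two of them, so a Dominator of bias 2 has to spend all
his vertices on them and never touches an odd [v_i].  The [k]-th move creates
three pairs, one too many. *)
Require Import Defs.
From mathcomp Require Import all_boot all_order all_algebra.
From mathcomp Require Import boolp constructive_ereal.
From mathcomp Require Import zify.

Set Implicit Arguments.
Unset Strict Implicit.
Unset Printing Implicit Defensive.

Local Open Scope nat_scope.

Lemma exists_superset_card (T : finType) (A B : {set T}) (m : nat) :
  A \subset B -> #|A| <= m -> m <= #|B| ->
  exists C : {set T}, [/\ A \subset C, C \subset B & #|C| = m].
Proof.
move=> sAB leAm; elim: m leAm => [|m IHm].
  by rewrite leqn0 => /eqP A0 _; exists A.
rewrite leq_eqVlt => /predU1P[<- _|]; first by exists A.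
rewrite ltnS => leAm ltmB.
have [C [sAC sCB cardC]] := IHm leAm (ltnW ltmB).
have /properP[_ [x xB xC]] : C \proper B by rewrite properEcard sCB cardC.
exists (x |: C); split; first exact: subset_trans sAC (subsetU1 x C).
- by rewrite subUset sub1set xB.
- by rewrite cardsU1 xC cardC.
Qed.

Lemma disjoint_setUl (T : finType) (A B C : {set T}) :
  [disjoint A :|: B & C] = [disjoint A & C] && [disjoint B & C].
Proof. by rewrite -!setI_eq0 setIUl setU_eq0. Qed.

Lemma disjoint_setUr (T : finType) (A B C : {set T}) :
  [disjoint A & B :|: C] = [disjoint A & B] && [disjoint A & C].
Proof. by rewrite -!setI_eq0 setIUr setU_eq0. Qed.

(** * Counting a set that meets pairwise disjoint sets *)

Section TransversalCounting.

Variables (T : finType) (N : nat) (P : nat -> {set T}) (D : {set T}).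
Hypothesis P_disjoint : forall c d u,
  c < N -> d < N -> u \in P c -> u \in P d -> c = d.
Hypothesis D_meets : forall c, c < N -> ~~ [disjoint P c & D].

Let transversal :
  {z : 'I_N -> T | injective z & forall c, z c \in P c :&: D}.
Proof.
have ex (c : 'I_N) : exists u, u \in P (val c) :&: D.
  by apply/set0Pn; rewrite setI_eq0; exact: (D_meets (ltn_ord c)).
pose z (c : 'I_N) := xchoose (ex c).
have zP c : z c \in P c :&: D := xchooseP (ex c).
exists z => // c d eqz; apply/val_inj.
have /setIP[zc _] := zP c; have /setIP[zd _] := zP d.
by apply: P_disjoint zc _; rewrite ?ltn_ord ?eqz.
Qed.

Lemma leq_card_meets : N <= #|D|.
Proof.
case: transversal => z z_inj zP.
rewrite -[N]card_ord -(card_imset _ z_inj) subset_leq_card //.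
by apply/subsetP=> _ /imsetP[c _ ->]; have /setIP[] := zP c.
Qed.

(** The tight case of the count: the transversal already has [N] elements, so it exhausts [D]. *)
Lemma meets_covers u : #|D| <= N -> u \in D -> exists2 c, c < N & u \in P c.
Proof.
case: transversal => z z_inj zP leDN.
have sub : z @: 'I_N \subset D.
  by apply/subsetP=> _ /imsetP[c _ ->]; have /setIP[] := zP c.
have /eqP <- : z @: 'I_N == D.
  by rewrite eqEcard sub (card_imset _ z_inj) card_ord.
by move=> /imsetP[c _ ->]; exists c => //; have /setIP[] := zP c.
Qed.

End TransversalCounting.

(** * Positions of the biased game on an arbitrary graph *)

Section BiasedGame.

Variable G : sgraph.
Implicit Types D S M : {set G}.

Definition closed_nbhd (v : G) : {set G} := [set u | (u == v) || adj u v].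

Lemma dominating_meets_nbhd D v :
  dominating D -> ~~ [disjoint closed_nbhd v & D].
Proof.
move=> /forallP/(_ v)/orP[vD|/existsP[u /andP[uD uv]]].
- by apply/pred0Pn; exists v; rewrite /= inE eqxx vD.
- by apply/pred0Pn; exists u; rewrite /= inE uv orbT uD.
Qed.

Lemma legal_move_disjoint b D S M :
  legal_move b D S M -> [disjoint M & D] /\ [disjoint M & S].
Proof.
rewrite /legal_move /unplayed setCU subsetI -!disjoints_subset.
by case/andP=> /andP[].
Qed.

(** A legal move has an exact size, so the wanted vertices are padded with arbitrary unplayed
    ones. *)
Lemma legal_move_extend b D S M :
  M \subset unplayed D S -> #|M| <= b ->
  exists2 M', legal_move b D S M' & M \subset M'.
Proof.
move=> sMU leMb.
have [|M' [sM sM'U /eqP cardM']] := exists_superset_card sMU _ (geq_minr b _).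
  by rewrite leq_min leMb subset_leq_card.
by exists M' => //; rewrite /legal_move sM'U.
Qed.

(** Along any play [S] only grows and stays disjoint from [D], while the final [D] meets every
    closed neighbourhood. *)
Lemma dominator_wins_nbhd_notin a b p D S v :
  dominator_wins a b p D S -> [disjoint D & S] -> ~~ (closed_nbhd v \subset S).
Proof.
elim=> {p D S} [p D S _ domD|D S M _ legM _ IH|D S _ _ IH] dDS.
- apply: contraNN (dominating_meets_nbhd v domD) => sNS.
  by apply: disjointWl sNS _; rewrite disjoint_sym.
- have [_ dMS] := legal_move_disjoint legM.
  by apply: IH; rewrite disjoint_setUl dDS.
- have [|M legM _] := @legal_move_extend b D S set0 (sub0set _).
    by rewrite cards0.
  have [dMD _] := legal_move_disjoint legM.
  have: ~~ (closed_nbhd v \subset S :|: M).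
    by apply: IH legM _; rewrite disjoint_setUr dDS disjoint_sym.
  by apply: contraNN => /subset_trans-> //; exact: subsetUl.
Qed.

(** Nonemptiness of [M] rules out [Wins_end]: on a full board the empty set is a legal move. *)
Lemma Staller_move_inv a b D S M :
  dominator_wins a b Staller D S -> legal_move b D S M -> M != set0 ->
  dominator_wins a b Dominator D (S :|: M).
Proof.
move E: Staller => p win; case: win E => {p D S} [p D S U0 _ _|//|D S _ win _].
  by rewrite /legal_move U0 subset0 => /andP[->].
by move/win.
Qed.

Lemma Dominator_move_inv a b D S :
  dominator_wins a b Dominator D S ->
  exists M, [/\ [disjoint M & S], #|M| <= a &
    dominator_wins a b Staller (D :|: M) S].
Proof.
move E: Dominator => p win.
case: win E => {p D S} [p D S U0 domD _|D S M _ legM win _|//].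
  exists set0; rewrite setU0 cards0 -setI_eq0 set0I; split=> //.
  exact: Wins_end.
exists M; have [_ dMS] := legal_move_disjoint legM; split=> //.
by case/andP: legM => _ /eqP->; exact: geq_minl.
Qed.

(** If [T] avoided [D], the rest of [T] would be unplayed and fit into one move, which would
    complete the neighbourhood of [v]. *)
Lemma Staller_completes_nbhd a b D S T v :
  dominator_wins a b Staller D S -> [disjoint D & S] ->
  closed_nbhd v \subset T :|: S -> #|T| <= b -> ~~ [disjoint T & D].
Proof.
move=> win dDS sNT leTb; apply/negP=> dTD.
have [T0|TS0] := eqVneq (T :\: S) set0.
  apply/negP: (dominator_wins_nbhd_notin v win dDS); rewrite negbK.
  by rewrite (subset_trans sNT) // subUset subxx andbT -setD_eq0 T0.
have [| |M legM sTM] := @legal_move_extend b D S (T :\: S).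
- rewrite /unplayed setCU subsetI -!disjoints_subset.
  by rewrite (disjointWl (subsetDl _ _) dTD) disjoints_subset setDE subsetIr.
- exact: leq_trans (subset_leq_card (subsetDl _ _)) leTb.
have M0 : M != set0 by apply: contraNneq TS0 => M0; rewrite -subset0 -M0.
have winM := Staller_move_inv win legM M0.
have [dMD _] := legal_move_disjoint legM.
have dDSM : [disjoint D & S :|: M].
  by rewrite disjoint_setUr dDS disjoint_sym.
apply/negP: (dominator_wins_nbhd_notin v winM dDSM); rewrite negbK.
apply: subset_trans sNT _; apply/subsetP=> u /setUP[uT|uS].
  have [uS|uS] := boolP (u \in S); first by rewrite inE uS.
  by rewrite inE (subsetP sTM) ?orbT // inE uS.
by rewrite inE uS.
Qed.

(** * The forcing strategy, abstracted from the grid *)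

Section ForcedChain.

(** On the grid, [x c] is the even vertex [v_2c], [y i] the odd vertex [v_(2i+1)], and [P c] the
    pair at [v_2c]. *)
Variables (k : nat) (x y : nat -> G) (P : nat -> {set G}).

Let Y j : {set G} := [set u | u \in map y (iota 0 j)].

Hypothesis card_P : forall c, #|P c| <= 2.
Hypothesis P_disjoint : forall c d u,
  c <= 2 * k -> d <= 2 * k -> u \in P c -> u \in P d -> c = d.
Hypothesis y_notin_P : forall i c, i < 2 * k -> c <= 2 * k -> y i \notin P c.
Hypothesis y_inj : forall i j, i < 2 * k -> j < 2 * k -> y i = y j -> i = j.
(** The minimum reflects the end of the side: the last centre [x (2 * k)] has no odd vertex after
    it. *)
Hypothesis nbhd_x : forall c, c <= 2 * k ->
  {subset closed_nbhd (x c) <= P c :|: Y (minn c.+1 (2 * k))}.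

Let Y_mono i j : i <= j -> Y i \subset Y j.
Proof.
move=> leij; apply/subsetP=> u; rewrite !inE -(subnKC leij) iotaD map_cat.
by rewrite mem_cat => ->.
Qed.

Let Dominator_meets_P a D j N :
  dominator_wins a 2 Staller D (Y j) -> [disjoint D & Y j] ->
  (forall c, c < N -> c <= 2 * k /\ minn c.+1 (2 * k) <= j) ->
  forall c, c < N -> ~~ [disjoint P c & D].
Proof.
move=> win dDY bound c /bound[ck cj].
apply: Staller_completes_nbhd win dDY _ (card_P c).
exact: subset_trans (introT subsetP (nbhd_x ck)) (setUS _ (Y_mono cj)).
Qed.

(** Induction on the number [k - j] of moves left in Staller's plan; [j] rounds have been played. *)
Let Staller_wins_from a D j : a <= 2 -> j <= k -> #|D| <= 2 * j ->
  [disjoint D & Y (2 * j)] -> ~ dominator_wins a 2 Staller D (Y (2 * j)).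
Proof.
move=> a2 + + +; move: {1}(k - j) (erefl (k - j)) => r.
elim: r j D => [|r IH] j D Er jk cardD dDY win.
  (* Here [j = k]: all [2 * k + 1] disjoint pairs must be met by at most [2 * k] vertices. *)
  have /leq_card_meets : forall c, c < (2 * k).+1 -> ~~ [disjoint P c & D].
    by apply: Dominator_meets_P win dDY _ => c; lia.
  by move/(_ P_disjoint); lia.
have meets c : c < 2 * j -> ~~ [disjoint P c & D].
  by move: c; apply: Dominator_meets_P win dDY _ => c; lia.
have disj c d u :
    c < 2 * j -> d < 2 * j -> u \in P c -> u \in P d -> c = d.
  by move=> cj dj; apply: P_disjoint; lia.
(* Meeting [2 * j] disjoint pairs uses up all of [D], so [D] lies inside the pairs, which contain no
   [y i]. *)
have yD i : i < 2 * k -> y i \notin D.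
  move=> ik; apply/negP=> /(meets_covers disj meets cardD)[c cj].
  by apply/negP/y_notin_P; lia.
pose M := [set y (2 * j); y (2 * j).+1].
have EY : Y (2 * j.+1) = Y (2 * j) :|: M.
  apply/setP=> u; rewrite (_ : 2 * j.+1 = 2 * j + 2); last by lia.
  by rewrite !inE iotaD map_cat mem_cat /= !inE.
have yY i : 2 * j <= i < 2 * k -> y i \notin Y (2 * j).
  move=> ij; rewrite inE; apply/mapP=> -[i']; rewrite mem_iota => i'j.
  by move/y_inj; lia.
have sMU : M \subset unplayed D (Y (2 * j)).
  apply/subsetP=> u /set2P[]->; rewrite inE inE negb_or yD ?yY //; lia.
have legM : legal_move 2 D (Y (2 * j)) M.
  have cardM : #|M| = 2.
    rewrite cards2; have [/y_inj|//] := eqVneq; lia.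
  have := subset_leq_card sMU; rewrite cardM => leU.
  by rewrite /legal_move sMU cardM (minn_idPl leU).
have M0 : M != set0 by apply/set0Pn; exists (y (2 * j)); rewrite set21.
have := Staller_move_inv win legM M0; rewrite -EY.
have [dMD _] := legal_move_disjoint legM.
case/Dominator_move_inv=> M' [dM' cardM']; apply: IH; [lia|lia| |].
  by have [+ _] := leq_card_setU D M'; lia.
by rewrite disjoint_setUl dM' andbT EY disjoint_setUr dDY disjoint_sym.
Qed.

Lemma Staller_wins_forced_chain a : a <= 2 -> ~ dominator_wins_Sgame G a 2.
Proof.
move=> a2; have Y0 : Y (2 * 0) = set0 by apply/setP=> u; rewrite !inE.
rewrite /dominator_wins_Sgame -{2}Y0; apply: Staller_wins_from => //.
  by rewrite cards0.
by rewrite -setI_eq0 set0I.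
Qed.

End ForcedChain.

End BiasedGame.

(** * The strategy on the grid *)

Lemma Staller_wins_grid k n a : 0 < n -> a <= 2 ->
  ~ dominator_wins_Sgame
      (cart_prod (path_graph (4 * k + 1)) (path_graph n)) a 2.
Proof.
case: n => // n _; rewrite addn1; set G := cart_prod _ _.
pose v i : G := (inord i, ord0).
(* For a single line the junk value [inord 1 = ord0] makes [w i = v i]. *)
pose w i : G := (inord i, inord 1).
have vE i : i <= 4 * k -> nat_of_ord (v i).1 = i by move=> ik; rewrite inordK.
have wE i : i <= 4 * k -> nat_of_ord (w i).1 = i by move=> ik; rewrite inordK.
apply: (@Staller_wins_forced_chain G k (fun c => v (2 * c))
  (fun i => v (2 * i).+1) (fun c => [set v (2 * c); w (2 * c)])).
- by move=> c; rewrite cards2; case: (_ != _).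
- move=> c d u ck dk.
  by move=> /set2P[]-> /set2P[] /(congr1 (fun u : G => nat_of_ord u.1));
    rewrite ?vE ?wE; lia.
- move=> i c ik ck; apply/set2P => -[] /(congr1 (fun u : G => nat_of_ord u.1));
    rewrite ?vE ?wE; lia.
- move=> i j ik jk /(congr1 (fun u : G => nat_of_ord u.1)); rewrite !vE; lia.
(* A vertex of the closed neighbourhood is [v (2 * c)] itself, its neighbour [w (2 * c)], or a
   neighbour on the side. *)
- move=> c ck [i j]; rewrite !inE => /orP[->//|/orP[]] /andP[] /= /eqP.
    rewrite /path_adj => -> /orP[/eqP//|/eqP j1].
    have -> : j = inord 1 by apply: val_inj; rewrite /= inordK -?j1 // j1.
    by rewrite eqxx orbT.
  move=> -> /=; have vc := vE (2 * c); rewrite /path_adj vc; last by lia.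
  have ltik : i < (4 * k).+1 := ltn_ord i.
  (* As [i] is [2c - 1] or [2c + 1], the index is [c - 1] or [c]; the latter needs [2c + 1 <= 4k],
     hence [c < 2k]. *)
  move=> i2c; apply/orP; right; apply/mapP; exists i./2.
    by rewrite mem_iota; lia.
  by congr (_, _); apply: val_inj; rewrite /= inordK; lia.
Qed.

Theorem proposition18 (k n : nat) (hk : 0 < k) (hn : 0 < n) :
  (3%:Z%:E <=
     Sgame_threshold (cart_prod (path_graph (4 * k + 1)) (path_graph n)) 2)%E.
Proof.
rewrite /Sgame_threshold; case: pselect => [ex|_]; last exact: leey.
case: ex_minnP => a /andP[_ /asboolP win] _.
rewrite lee_fin lez_nat ltnNge; apply/negP=> a2.
exact: Staller_wins_grid win.
Qed.
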